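(* For every $n\ge 1$ and $0\le k\le n$, $$s_n^k(231,312)=\begin{cases}2^{\frac{n-k-2}{2}}\left(\binom{\frac{n+k}{2}}{\frac{n-k}{2}}+\binom{\frac{n+k-2}{2}}{\frac{n-k}{2}}\right) & \text{if } n+k \text{ is even},\\[6pt] 0 & \text{otherwise.}\end{cases}$$
   Context: $S_n$ denotes the set of permutations of $\{1,\dots,n\}$ written in one-line notation $\pi=\pi_1\pi_2\cdots\pi_n$. For $\alpha\in S_m$, $\pi\in S_n$ contains the pattern $\alpha$ if there are indices $i_1<i_2<\dots<i_m$ such that $\pi_{i_1}\pi_{i_2}\cdots\pi_{i_m}$ is order-isomorphic to $\alpha$; otherwise $\pi$ avoids $\alpha$. For a set $T$ of patterns, $S_n^k(T)$ is the set of $\pi\in S_n$ that have exactly $k$ fixed points (indices $i$ with $\pi_i=i$) and avoid every pattern in $T$; $s_n^k(T)=|S_n^k(T)|$. The braces around $T$ are omitted, e.g. $s_n^k(231,312)=s_n^k(\{231,312\})$. The power $2^{(n-k-2)/2}$ is a rational number (it equals $1/2$ when $k=n$). *)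

(* Defs.v *)
From HB Require Import structures.
From mathcomp Require Import all_boot all_order all_algebra all_fingroup.

Set Implicit Arguments.
Unset Strict Implicit.
Unset Printing Implicit Defensive.

(* 'S_n permutes the 0-based positions 'I_n = {0, ..., n-1}; shifting positions
   and values together by one changes neither pattern containment nor the
   fixed points. *)

Definition contains (m n : nat) (alpha : 'S_m) (pi : 'S_n) : bool :=
  [exists f : {ffun 'I_m -> 'I_n},
    [forall a : 'I_m, forall b : 'I_m,
      [&& (a < b) ==> (f a < f b)
        & (pi (f a) < pi (f b)) == (alpha a < alpha b)]]].

Definition avoids (m n : nat) (alpha : 'S_m) (pi : 'S_n) : bool :=
  ~~ contains alpha pi.

Definition fixed_points (n : nat) (pi : 'S_n) : {set 'I_n} :=
  [set i | pi i == i].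

(* A pattern is packed with its length, so that a set of patterns may mix
   lengths. *)
Definition pattern := {m : nat & 'S_m}.

Definition Savoid (n k : nat) (T : seq pattern) : {set 'S_n} :=
  [set pi : 'S_n | (#|fixed_points pi| == k)
                   && all (fun t : pattern => avoids (tagged t) pi) T].

Definition savoid (n k : nat) (T : seq pattern) : nat := #|Savoid n k T|.

Definition one_line (m : nat) (w : seq nat) (i : 'I_m.+1) : 'I_m.+1 :=
  inord (nth 0 w i).-1.

Lemma one_line231_inj : injective (@one_line 2 [:: 2; 3; 1]).
Proof.
move=> [[|[|[|i]]] Hi] // [[|[|[|j]]] Hj] //= /(congr1 val);
  rewrite /one_line /= ?inordK //; move=> _; exact: val_inj.
Qed.

Lemma one_line312_inj : injective (@one_line 2 [:: 3; 1; 2]).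
Proof.
move=> [[|[|[|i]]] Hi] // [[|[|[|j]]] Hj] //= /(congr1 val);
  rewrite /one_line /= ?inordK //; move=> _; exact: val_inj.
Qed.

Definition perm231 : 'S_3 := perm one_line231_inj.
Definition perm312 : 'S_3 := perm one_line312_inj.

Definition p231 : pattern := Tagged (fun m => 'S_m) perm231.
Definition p312 : pattern := Tagged (fun m => 'S_m) perm312.

(* Main.v *)
Require Import Defs.
From mathcomp Require Import all_boot all_order all_algebra all_fingroup.
From mathcomp Require Import zify ring.

(** A permutation avoids 231 and 312 exactly when it is layered: cut the
    positions into consecutive intervals and reverse each of them in place.
    Indeed, if pi starts with the value v, every smaller value comes before
    every larger one (otherwise v, the larger and the smaller form 231), and the
    smaller values come in decreasing order (otherwise they form 312 with v), so
    pi reverses the positions 0, ..., v and maps the rest to itself; one goes on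
    with the rest ([first_layer], [avoids_layered]). A layered permutation is
    thus the same thing as the composition of n given by its interval lengths.

    Reversing an interval fixes its midpoint when the length is odd and nothing
    when it is even, so the fixed points are counted by the odd parts, and the
    quantity wanted is the number a(n, k) of compositions of n with k odd parts
    ([savoid_compositions]).

    A composition of n >= 3 either starts with 1; or starts with 2; or starts
    with a part of at least 3. Removing the 1, removing the 2, or
    subtracting 2 from the first part gives
      a(n, k) = a(n-1, k-1) + 2 a(n-2, k)
    ([num_odd_compositions_rec]). Since n and k have the same parity when
    a(n, k) is nonzero, write n = k + 2j; then Pascal's rule shows by a double
    induction that
      2 a(k + 2j, k) = 2^j (C(k+j, j) + C(k+j-1, j)). *)

Set Implicit Arguments.
Unset Strict Implicit.
Unset Printing Implicit Defensive.

(** * Layered functions on the natural numbers *)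

(** Patterns are handled on functions over nat, restricted to arguments below n,
    so that the induction peeling off layers changes n without changing types. *)
Definition no_231_312_below (n : nat) (f : nat -> nat) : Prop :=
  forall i j l, i < j -> j < l -> l < n ->
    ~~ (f l < f i < f j) /\ ~~ (f j < f l < f i).

(** The layered permutation of nat with interval lengths w; being the identity
    beyond them, it is an involution whatever w is. *)
Fixpoint layer (w : seq nat) (i : nat) : nat :=
  if w is a :: w' then
    if i < a then a.-1 - i else a + layer w' (i - a)
  else i.

Lemma layerK w : involutive (layer w).
Proof.
elim: w => [|a w IHw] i //=.
case: (ltnP i a) => Hi; first by rewrite ifT; lia.
by rewrite ltnNge leq_addr /= addKn IHw subnKC.
Qed.

Lemma layer_lt w i : i < sumn w -> layer w i < sumn w.
Proof.
elim: w i => [|a w IHw] i //= Hi.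
case: (ltnP i a) => Hia; first lia.
by rewrite ltn_add2l IHw //; lia.
Qed.

(** If i lies in a layer that does not contain l, then the value at l exceeds
    the value at i, while both patterns need it to be smaller; if i and l share
    a layer, the three values decrease. *)
Lemma layer_avoids w n : no_231_312_below n (layer w).
Proof.
move=> i j l Hij Hjl _; elim: w i j l Hij Hjl => [|a w IHw] i j l Hij Hjl /=.
  by split; lia.
case: (ltnP i a) => Hi; case: (ltnP j a) => Hj; case: (ltnP l a) => Hl;
  try by split; lia.
by rewrite !ltn_add2l; apply: IHw; lia.
Qed.

Lemma count_reversal_fixed a :
  count (fun i => a.-1 - i == i) (iota 0 a) = odd a.
Proof.
case: (boolP (odd a)) => Ha.
  (* The middle position. *)
  rewrite (@eq_in_count _ _ (pred1 a./2)); last first.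
    by move=> i; rewrite mem_iota /= => Hi; apply/eqP/eqP; lia.
  by rewrite count_uniq_mem ?iota_uniq // mem_iota; case: a Ha => //= a _; lia.
apply/eqP; rewrite -leqn0 leqNgt -has_count; apply/hasPn => i.
by rewrite mem_iota => Hi; lia.
Qed.

Lemma count_layer_fixed w :
  count (fun i => layer w i == i) (iota 0 (sumn w)) = count odd w.
Proof.
elim: w => [|a w IHw] //=.
rewrite iotaD count_cat -(count_reversal_fixed a) -IHw; congr (_ + _).
  by apply: eq_in_count => i; rewrite mem_iota /= => ->.
rewrite add0n -[X in iota X _]addn0 iotaDl count_map; apply: eq_count => i /=.
by rewrite ltnNge leq_addr /= addKn eqn_add2l.
Qed.

(** By strong induction on i: the value v = f 0 - i occurs at some l >= i, the
    values v+1, ..., f 0 being taken. If l > i, then f i < v would make 0, i, l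
    an occurrence of 312, and f i > v, hence f i > f 0, one of 231. *)
Lemma first_layer n f : 0 < n ->
    (forall x y, x < n -> y < n -> f x = f y -> x = y) ->
    (forall y, y < n -> exists2 x, x < n & f x = y) ->
    (forall x, x < n -> f x < n) ->
    no_231_312_below n f ->
  forall i, i <= f 0 -> f i = f 0 - i.
Proof.
move=> n0 finj fsurj flt favoid; elim/ltn_ind=> i IHi Hi.
case: (posnP i) => [-> | i0]; first by rewrite subn0.
have f0n := flt 0 n0.
have [|l Hl fl] := fsurj (f 0 - i); first lia.
have Hil : i <= l.
  rewrite leqNgt; apply/negP => Hli.
  by have := IHi l Hli ltac:(lia); lia.
case: (ltngtP i l) Hil => // [Hil _ | E _]; last by rewrite -fl E.
have [H231 H312] := favoid 0 i l i0 Hil Hl.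
have fil : f i <> f l by move=> E; have := finj i l ltac:(lia) Hl E; lia.
(* The values from f 0 - i + 1 to f 0 are taken before position i. *)
case: (leqP (f i) (f 0)) => Hfi; last lia.
case: (ltnP (f i) (f 0 - i)) => Hfi'; first lia.
have E := IHi (f 0 - f i) ltac:(lia) ltac:(lia).
by have := finj (f 0 - f i) i ltac:(lia) ltac:(lia) ltac:(lia); lia.
Qed.

(** The first layer has length f 0 + 1 and maps onto the values up to f 0, so f
    preserves the remaining interval, where the same argument applies after a
    shift. *)
Lemma avoids_layered n f :
    (forall x y, x < n -> y < n -> f x = f y -> x = y) ->
    (forall y, y < n -> exists2 x, x < n & f x = y) ->
    (forall x, x < n -> f x < n) ->
    no_231_312_below n f ->
  exists w, [/\ sumn w = n, 0 \notin w & forall i, i < n -> f i = layer w i].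
Proof.
elim/ltn_ind: n f => n IHn f finj fsurj flt favoid.
case: (posnP n) => [-> | n0]; first by exists [::].
have Hfirst := first_layer n0 finj fsurj flt favoid.
have f0n := flt 0 n0; set a := (f 0).+1.
have Hrest x : a <= x -> x < n -> a <= f x.
  move=> Hax Hx; rewrite leqNgt; apply/negP => Hfx.
  have E := Hfirst (f 0 - f x) ltac:(lia).
  by have := finj (f 0 - f x) x ltac:(lia) Hx ltac:(lia); lia.
have [||||| w [Hsum Hpos Hw]] := IHn (n - a) _ (fun i => f (a + i) - a).
- by lia.
- move=> x y Hx Hy E.
  have Hfx := Hrest (a + x) ltac:(lia) ltac:(lia).
  have Hfy := Hrest (a + y) ltac:(lia) ltac:(lia).
  by have := finj (a + x) (a + y) ltac:(lia) ltac:(lia) ltac:(lia); lia.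
- move=> y Hy; have [|x Hx fx] := fsurj (a + y); first lia.
  have Hax : a <= x.
    by rewrite leqNgt; apply/negP => Hxa; have := Hfirst x ltac:(lia); lia.
  by exists (x - a); rewrite ?subnKC ?fx ?addKn //; lia.
- move=> x Hx; have Hfx := Hrest (a + x) ltac:(lia) ltac:(lia).
  by have := flt (a + x) ltac:(lia); lia.
- move=> i j l Hij Hjl Hl.
  have Hfi := Hrest (a + i) ltac:(lia) ltac:(lia).
  have Hfj := Hrest (a + j) ltac:(lia) ltac:(lia).
  have Hfl := Hrest (a + l) ltac:(lia) ltac:(lia).
  have [] := favoid (a + i) (a + j) (a + l) ltac:(lia) ltac:(lia) ltac:(lia).
  by split; lia.
exists (a :: w); split=> /=; first lia.
  by rewrite inE negb_or Hpos.
move=> i Hi; case: (ltnP i a) => Hia; first by rewrite Hfirst //; lia.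
rewrite -Hw; last lia.
by rewrite (subnKC Hia) subnKC ?Hrest.
Qed.

(** The value at 0 reveals the length of the first layer; positivity of the parts
    rules out invisible layers of length 0. *)
Lemma layer_inj w1 w2 : 0 \notin w1 -> 0 \notin w2 -> sumn w1 = sumn w2 ->
  (forall i, i < sumn w1 -> layer w1 i = layer w2 i) -> w1 = w2.
Proof.
elim: w1 w2 => [|a w1 IH] [|b w2] //=; rewrite ?inE ?negb_or;
  try by move=> *; lia.
move=> /andP[a0 H1] /andP[b0 H2] Hs Hl.
have Eab : a = b by have := Hl 0; rewrite !ifT; lia.
move: Hs Hl; rewrite -Eab => Hs Hl; congr (_ :: _).
apply: IH => //; first lia.
move=> i Hi; have := Hl (a + i); rewrite !ltnNge !leq_addr /= !addKn.
by rewrite -!ltnNge ltn_add2l => /(_ Hi) /addnI.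
Qed.

(** * Layered permutations and the avoidance class *)

(** Falling back on i when the image leaves the range keeps this an involution
    for every w, so that no hypothesis on the sum of w is needed to build a
    permutation. *)
Definition layered_fun n w (i : 'I_n) : 'I_n := insubd i (layer w i).

Lemma layered_funK n w : involutive (@layered_fun n w).
Proof.
move=> i; apply: val_inj; rewrite /layered_fun !val_insubd.
case: (boolP (layer w i < n)) => H; first by rewrite layerK ltn_ord.
by rewrite (negPf H).
Qed.

Definition layered_perm n w : 'S_n := perm (inv_inj (@layered_funK n w)).

Lemma layered_permE n w (i : 'I_n) : sumn w = n ->
  layered_perm n w i = layer w i :> nat.
Proof.
move=> Hw; rewrite permE val_insubd ifT //.
by rewrite -[X in _ < X]Hw layer_lt // Hw.
Qed.

Lemma card_fixed_layered_perm n w : sumn w = n ->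
  #|fixed_points (layered_perm n w)| = count odd w.
Proof.
move=> Hw; rewrite -count_layer_fixed Hw -val_enum_ord count_map.
rewrite /fixed_points cardsE cardE size_filter -enumT.
apply: eq_count => i; rewrite /= -layered_permE //.
Qed.

(** The default value z of nth is the one returned at index 2. *)
Definition ord3 (T : Type) (x y z : T) (a : 'I_3) : T :=
  nth z [:: x; y] a.

Lemma contains3P n (alpha : 'S_3) (pi : 'S_n) :
  reflect
    (exists p : 'I_n * 'I_n * 'I_n, let: (i, j, l) := p in
       [/\ i < j, j < l &
        forall a b : 'I_3,
          (pi (ord3 i j l a) < pi (ord3 i j l b)) = (alpha a < alpha b)])
    (contains alpha pi).
Proof.
apply: (iffP existsP) => [[f /forallP Hf] | [[[i j] l] [Hij Hjl H]]].
  have H (a b : 'I_3) : (a < b -> f a < f b) /\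
      (pi (f a) < pi (f b)) = (alpha a < alpha b).
    by have /forallP/(_ b)/andP[/implyP H1 /eqP H2] := Hf a.
  pose o (k : nat) : 'I_3 := inord k.
  exists (f (o 0), f (o 1), f (o 2)); split.
  - by apply: (H _ _).1; rewrite !inordK.
  - by apply: (H _ _).1; rewrite !inordK.
  have E (a : 'I_3) : ord3 (f (o 0)) (f (o 1)) (f (o 2)) a = f a.
    by case: a => -[|[|[|k]]] Hk //=; rewrite /ord3 /=; congr (f _);
      apply: val_inj; rewrite /= inordK.
  by move=> a b; rewrite !E; apply: (H a b).2.
exists (finfun (ord3 i j l)); apply/forallP => a; apply/forallP => b.
rewrite !ffunE H eqxx andbT; apply/implyP.
by case: a b => -[|[|[|a]]] // Ha [[|[|[|b]]] Hb] //= _; rewrite /ord3 /=; lia.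
Qed.

Lemma contains231P n (pi : 'S_n) :
  reflect (exists p : 'I_n * 'I_n * 'I_n, let: (i, j, l) := p in
             [/\ i < j, j < l & pi l < pi i < pi j])
          (contains perm231 pi).
Proof.
apply: (iffP (contains3P _ _)) => -[[[i j] l] [Hij Hjl H]]; exists (i, j, l);
  split=> //.
  have := H (@Ordinal 3 2 isT) (@Ordinal 3 0 isT).
  have := H (@Ordinal 3 0 isT) (@Ordinal 3 1 isT).
  by rewrite !permE /one_line /= !inordK // /ord3 /= => -> ->.
by move=> [[|[|[|a]]] Ha] // [[|[|[|b]]] Hb] //;
  rewrite !permE /one_line /= !inordK // /ord3 /=; lia.
Qed.

Lemma contains312P n (pi : 'S_n) :
  reflect (exists p : 'I_n * 'I_n * 'I_n, let: (i, j, l) := p in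
             [/\ i < j, j < l & pi j < pi l < pi i])
          (contains perm312 pi).
Proof.
apply: (iffP (contains3P _ _)) => -[[[i j] l] [Hij Hjl H]]; exists (i, j, l);
  split=> //.
  have := H (@Ordinal 3 1 isT) (@Ordinal 3 2 isT).
  have := H (@Ordinal 3 2 isT) (@Ordinal 3 0 isT).
  by rewrite !permE /one_line /= !inordK // /ord3 /= => -> ->.
by move=> [[|[|[|a]]] Ha] // [[|[|[|b]]] Hb] //;
  rewrite !permE /one_line /= !inordK // /ord3 /=; lia.
Qed.

Definition nat_of_perm n (pi : 'S_n) (x : nat) : nat :=
  oapp (fun i => val (pi i)) x (insub x).

Lemma nat_of_permE n (pi : 'S_n) (i : 'I_n) : nat_of_perm pi i = pi i.
Proof. by rewrite /nat_of_perm valK. Qed.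

Lemma avoids_231_312P n (pi : 'S_n) :
  reflect (no_231_312_below n (nat_of_perm pi))
          (avoids perm231 pi && avoids perm312 pi).
Proof.
apply: (iffP andP) => [[H231 H312] i j l Hij Hjl Hl | H].
  pose l' := Ordinal Hl; pose j' := Ordinal (ltn_trans Hjl Hl).
  pose i' := Ordinal (ltn_trans Hij (ltn_ord j')).
  rewrite -[i]/(val i') -[j]/(val j') -[l]/(val l') !nat_of_permE.
  split; apply/negP => Hp.
    by case/negP: H231; apply/contains231P; exists (i', j', l').
  by case/negP: H312; apply/contains312P; exists (i', j', l').
split; apply/negP.
  case/contains231P => -[[i j] l] [Hij Hjl].
  by case: (H i j l Hij Hjl (ltn_ord l)); rewrite !nat_of_permE => /negP.
case/contains312P => -[[i j] l] [Hij Hjl].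
by case: (H i j l Hij Hjl (ltn_ord l)); rewrite !nat_of_permE => _ /negP.
Qed.

Lemma layered_perm_avoids n w : sumn w = n ->
  avoids perm231 (layered_perm n w) && avoids perm312 (layered_perm n w).
Proof.
move=> Hw; apply/avoids_231_312P => i j l Hij Hjl Hl.
have E x (Hx : x < n) : nat_of_perm (layered_perm n w) x = layer w x.
  by rewrite -(layered_permE (Ordinal Hx) Hw) -nat_of_permE.
by rewrite !E; [apply: (layer_avoids w Hij Hjl Hl) | lia..].
Qed.

Lemma avoiding_perm_layered n (pi : 'S_n) :
    avoids perm231 pi && avoids perm312 pi ->
  exists w, [/\ sumn w = n, 0 \notin w & pi = layered_perm n w].
Proof.
move=> /avoids_231_312P Hpi.
have [||| w [Hsum Hpos Hw]] := avoids_layered _ _ _ Hpi.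
- move=> x y Hx Hy; rewrite -[x]/(val (Ordinal Hx)) -[y]/(val (Ordinal Hy)).
  by rewrite !nat_of_permE => /val_inj /perm_inj ->.
- move=> y Hy; exists ((pi^-1)%g (Ordinal Hy)); first exact: ltn_ord.
  by rewrite nat_of_permE permKV.
- by move=> x Hx; rewrite -[x]/(val (Ordinal Hx)) nat_of_permE.
exists w; split=> //; apply/permP => i; apply: val_inj => /=.
by rewrite layered_permE // -nat_of_permE Hw.
Qed.

(** * Counting compositions by odd parts *)

Definition grow (w : seq nat) : seq nat :=
  if w is a :: w' then a.+1 :: w' else [::].

(** Compositions of m + 1 arise from those of m by putting a part 1 in front or
    by enlarging the first part; the empty composition of 0 has no part to
    enlarge. *)
Fixpoint compositions (n : nat) : seq (seq nat) :=
  if n is m.+1 then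
    map (cons 1) (compositions m) ++
    (if m is _.+1 then map grow (compositions m) else [::])
  else [:: [::]].

Lemma mem_compositions n w :
  (w \in compositions n) = (sumn w == n) && (0 \notin w).
Proof.
elim: n w => [|n IHn] w.
  by rewrite inE; case: w => [|[|a] w] //=; rewrite andbF.
apply/idP/andP => [|[/eqP Hw Hp]].
  rewrite /= mem_cat => /orP[/mapP[v] | ].
    rewrite IHn => /andP[/eqP Hv Hp] -> /=.
    by rewrite inE negb_or Hp Hv add1n.
  case: n IHn => // n IHn /mapP[[|a v]]; rewrite IHn //=.
  move=> /andP[/eqP Hv]; rewrite inE negb_or => /andP[a0 Hp] -> /=.
  by rewrite inE negb_or Hp -Hv addSn.
case: w Hw Hp => [|[|[|a]] w] //= Hw; rewrite !inE //= => Hp.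
  rewrite mem_cat map_f // IHn Hp andbT; lia.
rewrite mem_cat; apply/orP; right.
case: n IHn Hw => [|n] IHn Hw; first by lia.
by apply: (@map_f _ _ grow _ (a.+1 :: w)); rewrite IHn /= inE Hp andbT; lia.
Qed.

Lemma compositions_uniq n : uniq (compositions n).
Proof.
elim: n => [|n IHn] //=.
rewrite cat_uniq map_inj_uniq ?IHn /=; last by move=> u v [].
case: n IHn => // n IHn; rewrite map_inj_in_uniq ?IHn ?andbT.
  apply/hasPn => _ /mapP[v + ->]; rewrite mem_compositions.
  by case: v => [|[|a] v]; rewrite ?inE ?andbF //= => _; apply/mapP => -[u _ []].
by move=> [|a u] [|b v]; rewrite !mem_compositions // => _ _ [-> ->].
Qed.

Definition num_odd_compositions n k :=
  count (fun w => count odd w == k) (compositions n).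

(** The map from compositions to layered permutations is a bijection onto the
    avoidance class that turns odd parts into fixed points. *)
Lemma savoid_compositions n k :
  savoid n k [:: p231; p312] = num_odd_compositions n k.
Proof.
rewrite /savoid /num_odd_compositions -size_filter.
rewrite -(size_map (layered_perm n)); set s := map _ _.
have Hs : uniq s.
  rewrite map_inj_in_uniq ?filter_uniq ?compositions_uniq // => u v.
  rewrite !mem_filter !mem_compositions.
  move=> /and3P[_ /eqP Hu Pu] /and3P[_ /eqP Hv Pv] E.
  apply: layer_inj => //; first by rewrite Hu.
  move=> i; rewrite Hu => Hi.
  by have := layered_permE (Ordinal Hi) Hu;
    rewrite E (layered_permE (Ordinal Hi) Hv).
rewrite -(card_uniqP Hs); apply: eq_card => pi.
rewrite inE /= andbT; apply/andP/mapP => [[/eqP Hk /avoiding_perm_layered] | ].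
  move=> [w [Hw Pw Epi]]; exists w => //.
  rewrite mem_filter mem_compositions Hw Pw -Hk Epi.
  by rewrite card_fixed_layered_perm ?eqxx.
move=> [w]; rewrite mem_filter mem_compositions => /and3P[Hk /eqP Hw _] ->.
by rewrite card_fixed_layered_perm // Hk; split=> //; apply: layered_perm_avoids.
Qed.

(** The sum of the parts has the parity of the number of odd parts and is at
    least that number. *)
Lemma num_odd_compositions_eq0 n k : odd (n + k) || (n < k) ->
  num_odd_compositions n k = 0.
Proof.
move=> H; apply/eqP; rewrite -leqn0 leqNgt -has_count; apply/hasPn => w.
rewrite mem_compositions => /andP[/eqP Hw _]; apply/negP => /eqP Hk.
have : (count odd w <= sumn w) && (odd (sumn w) == odd (count odd w)).
  by elim: (w) => //= a v /andP[]; case: (boolP (odd a)); lia.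
by rewrite Hw Hk; lia.
Qed.

(** Unfolding the enumeration twice splits it by the first part: 1, 2, or at
    least 3. A first part of 2 is removed and one of at least 3 lowered by 2,
    neither of which changes the number of odd parts. Lowering needs a nonempty
    remainder, so the recurrence starts at size 3. *)
Lemma num_odd_compositions_rec n k :
  num_odd_compositions n.+3 k =
  (if k is k'.+1 then num_odd_compositions n.+2 k' else 0)
  + 2 * num_odd_compositions n.+1 k.
Proof.
have compSS m : compositions m.+2 =
  map (cons 1) (compositions m.+1) ++ map grow (compositions m.+1) by [].
rewrite /num_odd_compositions compSS {2}compSS.
move: (compositions n.+2) (compositions n.+1) => s2 s1.
rewrite map_cat !count_cat -!map_comp !count_map mul2n -addnn.
congr (_ + (_ + _)); last by apply: eq_count => -[|a w] //=; rewrite negbK.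
case: k => [|k]; last by [].
by rewrite -[RHS](count_pred0 s2).
Qed.

Lemma num_odd_compositions_all_odd k : num_odd_compositions k k = 1.
Proof.
elim/ltn_ind: k => -[|[|[|k]]] // IHk.
rewrite num_odd_compositions_rec IHk // num_odd_compositions_eq0 //.
by rewrite ltnS leqnSn orbT.
Qed.

(** Doubling keeps the formula in nat although the exponent j - 1 may be
    negative. Apart from the initial values, the recurrence reduces it to
    Pascal's rule. *)
Lemma num_odd_compositions_closed k j :
  2 * num_odd_compositions (k + 2 * j) k =
  2 ^ j * ('C(k + j, j) + 'C(k + j - 1, j)).
Proof.
elim: j k => [|j IHj] k.
  by rewrite muln0 !addn0 num_odd_compositions_all_odd !bin0.
elim: k => [|k IHk].
  case: j IHj => [|j] IHj; first by [].
  have -> : 0 + 2 * j.+2 = (0 + 2 * j).+4 by lia.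
  rewrite num_odd_compositions_rec add0n.
  have -> : (0 + 2 * j).+2 = 0 + 2 * j.+1 by lia.
  rewrite IHj !add0n !subn1 /= !binn !bin_small // !expnS; lia.
have -> : k.+1 + 2 * j.+1 = (k + 2 * j).+3 by lia.
rewrite num_odd_compositions_rec mulnDr.
have -> : (k + 2 * j).+2 = k + 2 * j.+1 by lia.
have -> : (k + 2 * j).+1 = k.+1 + 2 * j by lia.
rewrite IHk IHj !addSn !addnS !subn1 /= !binS !expnS; ring.
Qed.

Import GRing.Theory.

Local Open Scope ring_scope.

Theorem theorem2p9 (n k : nat) (hn : (1 <= n)%N) (hk : (k <= n)%N) :
  (savoid n k [:: p231; p312])%:R =
  (if ~~ odd (n + k) then
     2%:R ^ ((n%:Z - k%:Z - 2) %/ 2)%Z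
     * ('C((n + k) %/ 2, (n - k) %/ 2)%:R
        + 'C((n + k - 2) %/ 2, (n - k) %/ 2)%:R)
   else 0) :> rat.
Proof.
rewrite savoid_compositions; case: ifPn => [even_nk | /negPn odd_nk]; last first.
  by rewrite num_odd_compositions_eq0 ?odd_nk.
pose j := (n - k)./2.
have -> : n = (k + 2 * j)%N by rewrite /j; lia.
have -> : ((k + 2 * j + k) %/ 2)%N = (k + j)%N by lia.
have -> : ((k + 2 * j + k - 2) %/ 2)%N = (k + j - 1)%N by lia.
have -> : ((k + 2 * j - k) %/ 2)%N = j by lia.
have -> : (((k + 2 * j)%N%:Z - k%:Z - 2) %/ 2)%Z = j%:Z - 1 by lia.
have two0 : 2%:R != 0 :> rat by [].
apply: (mulfI two0); rewrite -natrM num_odd_compositions_closed.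
rewrite natrM natrD natrX mulrA; congr (_ * _).
by rewrite expfzDr // exprN1 mulrCA mulfV // mulr1.
Qed.
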